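(* Suppose $0<p<\infty$. Let $W\in\mathbf{A}_p(\mathcal{B}_A)$ be a matrix weight on $\mathbb{R}^d$ with values in $\mathbb{C}^{N\times N}$, and let $T_r:=\delta_r\cdot+c$, i.e. $T_r(x)=\delta_rx+c$, for some $r>0$ and $c\in\mathbb{R}^d$. Then $$[W\circ T_r]_{\mathbf{A}_p(\mathcal{B}_A)}=[W]_{\mathbf{A}_p(\mathcal{B}_A)}.$$
   Context: Dilation structure: $A$ is a fixed real symmetric $d\times d$ matrix with strictly positive eigenvalues; $\delta_t:=\exp(A\ln t)$ for $t>0$. Fix a strictly positive symmetric matrix $P$ such that for every $\xi\in\mathbb{R}^d\setminus\{0\}$ the function $t\mapsto[\delta_t\xi]_P:=\langle P\delta_t\xi,\delta_t\xi\rangle^{1/2}$ is strictly increasing on $(0,\infty)$ (such $P$ exists). Define $|0|_A:=0$ and, for $\xi\ne0$, let $|\xi|_A$ be the unique $t>0$ with $[\delta_{1/t}\xi]_P=1$. The matrix $P$ is scaled so that $\{|\zeta|_A<1\}\subseteq\{|z|<2\}$. Put $B_A(\xi,r):=\{\zeta\in\mathbb{R}^d:|\xi-\zeta|_A<r\}$ and $\mathcal{B}_A:=\{B_A(\xi,r):\xi\in\mathbb{R}^d,r>0\}$. Matrix weights: a matrix weight is a measurable function $W:\mathbb{R}^d\to\mathbb{C}^{N\times N}$ that is strictly positive definite almost everywhere; real powers are taken in the sense of the functional calculus; $\|\cdot\|$ is a fixed matrix norm; $\fint_E f:=|E|^{-1}\int_E f$. For $0<p\le1$, $$[W]_{\mathbf{A}_p(\mathcal{B}_A)}:=\sup_{E\in\mathcal{B}_A}\operatorname*{ess\,sup}_{t\in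 E}\fint_E\|W^{1/p}(x)W^{-1/p}(t)\|^p\,dx,$$ and for $1<p<\infty$, $1/p+1/p'=1$, $$[W]_{\mathbf{A}_p(\mathcal{B}_A)}:=\sup_{E\in\mathcal{B}_A}\Big[\fint_E\Big(\fint_E\|W^{1/p}(x)W^{-1/p}(t)\|^{p'}dt\Big)^{p/p'}dx\Big]^{1/p}.$$ $W\in\mathbf{A}_p(\mathcal{B}_A)$ means $[W]_{\mathbf{A}_p(\mathcal{B}_A)}<\infty$. *)

(* Defs.v *)
From HB Require Import structures.
From mathcomp Require Import all_boot all_order all_algebra.
From mathcomp Require Import sesquilinear spectral.
From mathcomp Require Import complex.
From mathcomp Require Import all_classical all_reals all_analysis.

Set Implicit Arguments.
Unset Strict Implicit.
Unset Printing Implicit Defensive.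

Import Order.TTheory GRing.Theory Num.Theory.
Import numFieldNormedType.Exports.

Local Open Scope classical_set_scope.
Local Open Scope complex_scope.
Local Open Scope ring_scope.

(* R^d with d >= 1 is represented by ['cV[R]_d.+1], so the dimension is the
   successor of the natural number [d].  The Lebesgue measure on it is obtained
   by Caratheodory's construction from the outer measure given by countable
   covers by half-open boxes; the measurable sets of [Rd R d] are therefore the
   Lebesgue measurable sets (the measure is complete). *)

Section LebesgueRd.
Context {R : realType} {d : nat}.
Local Notation V := 'cV[R]_d.+1.
Local Open Scope ereal_scope.

Definition box (ab : V * V) : set V :=
  [set x | forall i, (ab.1 i 0 <= x i 0 < ab.2 i 0)%R].

Definition volume (ab : V * V) : R := (\prod_i (ab.2 i 0 - ab.1 i 0))%R.

Definition box_cover (X : set V) : set (nat -> V * V) :=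
  [set F : nat -> V * V | (forall k i, ((F k).1 i 0 <= (F k).2 i 0)%R) /\
           X `<=` \bigcup_k box (F k)].

Definition lebesgue_outer (X : set V) : \bar R :=
  ereal_inf [set \sum_(k <oo) (volume (F k))%:E | F in box_cover X].

Lemma volume_ge0 (ab : V * V) :
  (forall i, (ab.1 i 0 <= ab.2 i 0)%R) -> 0 <= (volume ab)%:E.
Proof.
by move=> ab0; rewrite lee_fin; apply: prodr_ge0 => i _; rewrite subr_ge0.
Qed.

Lemma lebesgue_outer_ge0 (X : set V) : 0 <= lebesgue_outer X.
Proof.
apply: le_ereal_inf_tmp => _ [F [F0 _] <-].
by apply: nneseries_ge0 => k _ _; apply: volume_ge0 => i; exact: F0.
Qed.

Lemma lebesgue_outer0 : lebesgue_outer set0 = 0.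
Proof.
apply/eqP; rewrite eq_le lebesgue_outer_ge0 andbT.
apply: ereal_inf_lbound; exists (fun=> (0, 0)%R).
  by split=> // k i /=; rewrite lexx.
apply: eseries0 => k _ _.
by rewrite /volume (bigD1 ord0)//= subrr mul0r.
Qed.

Lemma le_lebesgue_outer :
  {homo lebesgue_outer : A B / A `<=` B >-> A <= B}.
Proof.
move=> A B AB; apply/ereal_inf_le_tmp => _ [F [F0 BF] <-].
by exists F => //; split => //; apply: subset_trans AB BF.
Qed.

Lemma lebesgue_outer_sigma_subadditive : sigma_subadditive lebesgue_outer.
Proof.
move=> A; have [[i ioo]|] := pselect (exists i, lebesgue_outer (A i) = +oo).
  rewrite (eseries_pinfty _ _ ioo) ?leey// => n _.
  by rewrite -ltNye (lt_le_trans _ (lebesgue_outer_ge0 _)).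
rewrite -forallNE => Aoo.
suff add2e (e : {posnum R}) : lebesgue_outer (\bigcup_n A n) <=
    \sum_(i <oo) lebesgue_outer (A i) + e%:num%:E.
  by apply/lee_addgt0Pr => _/posnumP[].
rewrite (le_trans _ (epsilon_trick _ _ _))//; last first.
  by move=> n; exact: lebesgue_outer_ge0.
pose P n (B : nat -> V * V) := box_cover (A n) B /\
  \sum_(k <oo) (volume (B k))%:E
    <= lebesgue_outer (A n) + (e%:num / (2 ^ n.+1)%:R)%:E.
have [G PG] : {G : nat -> nat -> V * V & forall n, P n (G n)}.
  apply: (@choice _ _ P) => n; rewrite /P /lebesgue_outer.
  set S := (X in ereal_inf X); move infS : (ereal_inf S) => iS.
  case: iS infS => [r Sr|Soo|Soo].
  - have en1 : (0 < e%:num / (2 ^ n.+1)%:R)%R by [].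
    have /(lb_ereal_inf_adherent en1) : ereal_inf S \is a fin_num by rewrite Sr.
    move=> [x [B [mB AnB muBx] xS]].
    by exists B; split => //; rewrite muBx -Sr; exact/ltW.
  - by have := Aoo n; rewrite /lebesgue_outer Soo.
  - by have := lebesgue_outer_ge0 (A n); rewrite /lebesgue_outer Soo.
pose v (x : nat * nat) : \bar R := (volume (G x.1 x.2))%:E.
have v_ge0 x : 0 <= v x.
  by apply: volume_ge0 => i; exact: ((PG x.1).1.1).
apply: (@le_trans _ _ (\esum_(x in setT) v x)).
  apply: ereal_inf_lbound => /=.
  have /card_esym/ppcard_eqP[f] := card_nat2.
  exists (fun k => G (f k).1 (f k).2).
    split => [k i|]; first exact: ((PG (f k).1).1.1).
    move=> t [i _] /(PG i).1.2 [j _ Bijt]; exists (f^-1%FUN (i, j)) => //=.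
    by rewrite invK ?inE.
  rewrite -(esum_pred_image v f xpredT) ?[fun=> _]set_true//.
  by rewrite image_eq.
rewrite (_ : esum _ _ = \sum_(i <oo) \sum_(j <oo) v (i, j)); last first.
  pose J : nat -> set (nat * nat) := fun i => [set (i, j) | j in setT].
  rewrite (_ : setT = \bigcup_k J k); last first.
    by rewrite predeqE => -[a b]; split => // _; exists a => //; exists b.
  rewrite esum_bigcupT /=; last 2 first.
    - apply/trivIsetP => i j _ _ ij.
      rewrite predeqE => -[n m] /=; split => //= -[] [_] _ [<-{n} _].
      by move=> [m' _] [] /esym/eqP; rewrite (negbTE ij).
    - exact: v_ge0.
  rewrite -(image_id [set: nat]) -fun_true esum_pred_image//; last first.
    by move=> n _; apply: esum_ge0 => x _; exact: v_ge0.
  apply: eq_eseriesr => /= j _.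
  rewrite -(esum_pred_image v (pair j) predT)//=; last first.
    by move=> ? ? _ _; exact: (@can_inj _ _ _ snd).
  by congr esum; rewrite predeqE => -[a b]; split; move=> [i _ <-]; exists i.
apply: lee_lim.
- apply: is_cvg_nneseries => n *.
  by apply: nneseries_ge0 => m *; exact: (v_ge0 (n, m)).
- by apply: is_cvg_nneseries => n *; apply: adde_ge0 => //;
    exact: lebesgue_outer_ge0.
- by near=> n; apply: lee_sum => i _; exact: (PG i).2.
Unshelve. all: by end_near. Qed.

HB.instance Definition _ := isOuterMeasure.Build R V lebesgue_outer
  lebesgue_outer0 lebesgue_outer_ge0 le_lebesgue_outer
  lebesgue_outer_sigma_subadditive.

End LebesgueRd.

Notation Rd R d := (caratheodory_type (@lebesgue_outer R d)).

Definition lebesgue_Rd {R : realType} {d : nat} : set (Rd R d) -> \bar R :=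
  @lebesgue_outer R d.

HB.instance Definition _ (R : realType) (d : nat) :=
  isMeasure.Build _ (Rd R d) R (@lebesgue_Rd R d)
    (@caratheodory_measure0 _ _ (@lebesgue_outer R d))
    (@caratheodory_measure_ge0 _ _ (@lebesgue_outer R d))
    (@caratheodory_measure_sigma_additive _ _ (@lebesgue_outer R d)).

Section Dilation.
Context {R : realType} {d : nat}.
Implicit Types (A P : 'M[R]_d.+1) (x y xi : 'cV[R]_d.+1).

Definition dotp x y : R := (x^T *m y) 0 0.

Definition expmx A : 'M[R]_d.+1 :=
  limn (series (fun k => (k`!%:R)^-1 *: A ^+ k)).

Definition delta A (t : R) : 'M[R]_d.+1 := expmx (ln t *: A).

Definition normP P x : R := Num.sqrt (dotp (P *m x) x).

(* For xi <> 0 the set below is a singleton under [dilation_structure]. *)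
Definition normA A P xi : R :=
  if xi == 0 then 0
  else get [set t | 0 < t /\ normP P (delta A t^-1 *m xi) = 1].

Definition ballA A P xi (r : R) : set 'cV[R]_d.+1 :=
  [set zeta | normA A P (xi - zeta) < r].

Definition ballsA A P : set (set 'cV[R]_d.+1) :=
  [set E | exists xi, exists2 r, 0 < r & E = ballA A P xi r].

Record dilation_structure A P : Prop := {
  dil_sym : A^T = A ;
  dil_eigen : forall a, eigenvalue A a -> 0 < a ;
  dilP_sym : P^T = P ;
  dilP_pos : forall x, x != 0 -> 0 < dotp (P *m x) x ;
  dilP_incr : forall xi, xi != 0 -> forall s t, 0 < s -> s < t ->
    normP P (delta A s *m xi) < normP P (delta A t *m xi) ;
  dilP_scaled : [set zeta | normA A P zeta < 1] `<=`
                [set z | Num.sqrt (dotp z z) < 2] }.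

End Dilation.

Section MatrixWeight.
Context {R : realType} {d N : nat}.
Local Notation C := R[i].
Local Open Scope sesquilinear_scope.
Implicit Types (W : Rd R d -> 'M[C]_N) (M : 'M[C]_N).

(* [0 < z] on R[i] means that z is real and positive, so this forces M to be
   Hermitian. *)
Definition posdefmx M : Prop :=
  forall z : 'cV[C]_N, z != 0 -> 0 < (z ^t* *m M *m z) 0 0.

(* Functional calculus: s-th powers of the eigenvalues in the unitary
   diagonalization of M. *)
Definition powmx M (s : R) : 'M[C]_N :=
  invmx (spectralmx M)
    *m diag_mx (map_mx (fun z : C => ((complex.Re z) `^ s)%:C) (spectral_diag M))
    *m spectralmx M.

Record matrix_weight W : Prop := {
  weight_measurable : forall i j,
    measurable_fun [set: Rd R d] (fun x => complex.Re (W x i j)) /\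
    measurable_fun [set: Rd R d] (fun x => complex.Im (W x i j)) ;
  weight_posdef : \forall x \ae lebesgue_Rd, posdefmx (W x) }.

(* [complex.Re `|a|] is the modulus of a as an element of R. *)
Record matrix_norm (nrm : 'M[C]_N -> R) : Prop := {
  mxnorm_eq0 : forall M, nrm M = 0 -> M = 0 ;
  mxnormZ : forall a M, nrm (a *: M) = complex.Re `|a| * nrm M ;
  mxnormD : forall M M', nrm (M + M') <= nrm M + nrm M' }.

Local Open Scope ereal_scope.

Definition avg (E : set (Rd R d)) (f : Rd R d -> \bar R) : \bar R :=
  (lebesgue_Rd E)^-1 * \int[lebesgue_Rd]_(x in E) f x.

Definition ess_sup_in (E : set (Rd R d)) (f : Rd R d -> \bar R) : \bar R :=
  ereal_inf [set y | \forall t \ae lebesgue_Rd, E t -> f t <= y].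

Definition Ap_kernel (nrm : 'M[C]_N -> R) (p : R) W (x t : Rd R d) : R :=
  nrm (powmx (W x) p^-1 *m powmx (W t) (- p^-1)%R).

(* The solution p' of 1/p + 1/p' = 1. *)
Definition conj_exp (p : R) : R := ((1 - p^-1)^-1)%R.

Definition Ap_const (nrm : 'M[C]_N -> R) (A P : 'M[R]_d.+1) (p : R) W : \bar R :=
  if (p <= 1)%R then
    ereal_sup [set ess_sup_in E (fun t =>
                 avg E (fun x => ((Ap_kernel nrm p W x t) `^ p)%:E))
              | E in ballsA A P]
  else
    let p' := conj_exp p in
    ereal_sup [set (avg E (fun x =>
                 (avg E (fun t => ((Ap_kernel nrm p W x t) `^ p')%:E))
                   `^ (p / p')%R)) `^ p^-1
              | E in ballsA A P].

Definition in_Ap nrm A P p W : Prop :=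
  matrix_weight W /\ Ap_const nrm A P p W < +oo.

End MatrixWeight.

(* Main.v *)
Require Import Defs.
From HB Require Import structures.
From mathcomp Require Import all_boot all_order all_algebra.
From mathcomp Require Import sesquilinear spectral mxred complex.
From mathcomp Require Import all_classical all_reals all_analysis.
From mathcomp Require Import ring lra.

(** The average over a ball and the essential supremum over a ball are
    invariant under an affine bijection f that multiplies the Lebesgue measure
    by a constant: in an average the constant cancels, and null sets are
    preserved ([avg_preimage], [ess_sup_in_preimage]).  The weight enters the
    constant only through the kernel, and the kernel of W o f at (x, t) is that
    of W at (f x, f t), so the term of W o f on the set f^-1(E) is the term of W
    on E.  If f permutes the balls, the two suprema are then over the same
    values ([Ap_const_comp]).  It remains to see two things about
    f x = delta_r x + c.

    Balls: since t |-> delta_t is a multiplicative group, |delta_r x|_A is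
    r |x|_A ([normA_delta]), so f^-1 and f carry balls to balls.  The group law
    is read off a diagonalization of A over the reals, in which delta_t is
    diag(t^v_j).

    Measure: delta_r is the square of the symmetric invertible matrix
    delta_(sqrt r), hence positive definite, and a positive definite matrix is
    a product of positive diagonal matrices and transvections, by block
    elimination ([posdef_elementary_product]).  Diagonal matrices carry boxes to
    boxes.  For a transvection, cutting a box into m thin strips covers its
    preimage by boxes of total volume vol + O(1/m), so the outer measure does
    not increase; the inverse is a transvection as well, so it does not
    decrease either.  Working with the outer measure of arbitrary sets makes
    these statements stable under composition, and it gives at once that
    measurable sets are preserved. *)

Set Implicit Arguments.
Unset Strict Implicit.
Unset Printing Implicit Defensive.

Import Order.TTheory GRing.Theory Num.Theory.
Import numFieldNormedType.Exports.

Local Open Scope classical_set_scope.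
Local Open Scope complex_scope.
Local Open Scope ring_scope.

(** * Diagonalization and the matrix exponential *)

(** The complexification of A is Hermitian, hence diagonalizable with real
    eigenvalues; two real matrices that are similar over the complex numbers are
    similar over the reals. *)
Lemma symmetric_diagonalizable (R : realType) n (A : 'M[R]_n) : A^T = A ->
  exists2 P : 'M[R]_n, P \in unitmx &
  exists v : 'rV[R]_n, A = invmx P *m diag_mx v *m P.
Proof.
move=> symA; pose toC := real_complex R : {rmorphism R -> R[i]}.
pose AC := map_mx toC A.
have realC m1 m2 (M : 'M[R]_(m1, m2)) : map_mx toC M \is a realmx.
  by apply/mxOverP => i j; rewrite mxE; apply/complex_realP; exists (M i j).
have hermAC : AC \is hermsymmx.
  apply: realsym_hermsym; last exact: realC.
  by apply/is_hermitianmxP; rewrite expr0 scale1r map_mx_id// map_trmx symA.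
have := hermitian_spectral_diag_real hermAC.
set vC := spectral_diag AC => vC_real.
pose v := map_mx (@complex.Re R) vC.
have vE : vC = map_mx toC v.
  by apply/matrixP => i j; rewrite !mxE; apply/esym/RRe_real/(mxOverP vC_real).
have AE : AC = invmx (spectralmx AC) *m diag_mx vC *m spectralmx AC.
  exact/orthomx_spectralP/hermitian_normalmx.
have simA : similar_in unitmx AC (diag_mx vC).
  exists (spectralmx AC); first exact: spectral_unit.
  apply/(similarP (spectral_unit _)).
  by rewrite {2}AE -mulmxA mulKVmx// spectral_unit.
have [|PC] := real_similar simA (realC _ _ A).
  by rewrite vE -map_diag_mx; exact: realC.
rewrite inE => /andP[PCreal PCunit] /(similarP PCunit) PCE.
pose P := map_mx (@complex.Re R) PC.
have PE : PC = map_mx toC P.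
  by apply/matrixP => i j; rewrite !mxE; apply/esym/RRe_real/(mxOverP PCreal).
have Punit : P \in unitmx by move: PCunit; rewrite PE map_unitmx.
exists P => //; exists v; rewrite -mulmxA; apply: (canRL (mulKmx Punit)).
apply: (@map_mx_inj _ _ toC).
by rewrite !map_mxM map_diag_mx -PE -vE.
Qed.

Lemma cvg_mx (R : realType) m n (F : nat -> 'M[R]_(m, n)) (M : 'M[R]_(m, n)) :
  (forall i j, F k i j @[k --> \oo] --> M i j) -> F @ \oo --> M.
Proof.
move=> FM B [P nbhsP PB].
have near_k : \forall k \near \oo, forall i j, P i j (F k i j).
  have near_kij i j : \forall k \near \oo, P i j (F k i j).
    exact: FM _ _ _ (nbhsP i j).
  apply: filter_forall => i; apply: filter_forall => j; exact: near_kij.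
by apply: filterS near_k => k Pk; exact: PB.
Qed.

Lemma cvg_exp_series_diag (R : realType) d (P : 'M[R]_d.+1) (v : 'rV[R]_d.+1) :
  P \in unitmx ->
  series (fun k => (k`!%:R)^-1 *: (invmx P *m diag_mx v *m P) ^+ k) @ \oo -->
  invmx P *m diag_mx (map_mx expR v) *m P.
Proof.
move=> Punit.
have powE k : (invmx P *m diag_mx v *m P) ^+ k
    = invmx P *m diag_mx (map_mx (fun x => x ^+ k) v) *m P.
  elim: k => [|k IHk].
    rewrite expr0 (_ : map_mx _ _ = const_mx 1); last first.
      by apply/matrixP => i j; rewrite !mxE.
    by rewrite diag_const_mx mulmx1 mulVmx.
  rewrite exprS IHk -[_ * _]/(_ *m _) !mulmxA mulmxK// -!mulmxA (mulmxA (diag_mx v)).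
  rewrite mulmx_diag; congr (_ *m (diag_mx _ *m _)).
  by apply/matrixP => i j; rewrite !mxE ord1 exprS.
have entry (w : 'rV[R]_d.+1) i j : (invmx P *m diag_mx w *m P) i j =
    \sum_l (invmx P) i l * P l j * w 0 l.
  rewrite mxE; apply: eq_bigr => l _.
  rewrite mul_mx_diag mxE -!mulrA; congr (_ * _); exact: mulrC.
apply: cvg_mx => i j; rewrite entry.
under eq_fun => n.
  rewrite /series /= summxE.
  under eq_bigr => k _ do rewrite mxE powE entry big_distrr /=.
  rewrite exchange_big /=.
  over.
apply: cvg_big => [|l _]; first exact: add_continuous.
have -> : (fun n => \sum_(0 <= k < n) (k`!%:R)^-1 *
    ((invmx P) i l * P l j * (map_mx (fun x => x ^+ k) v) 0 l)) =
  (fun n => (invmx P) i l * P l j * series (exp_coeff (v 0 l)) n).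
  apply/funext => n; rewrite /series /= big_distrr /=; apply: eq_bigr => k _.
  by rewrite mxE exp_coeffE; ring.
rewrite mxE; apply: cvgMl_tmp; exact: is_cvg_series_exp_coeff.
Qed.

(** * The dilation group *)

(** The substitution t = r u in the equation that defines the homogeneous norm;
    phi is strictly increasing, so the equation has at most one solution. *)
Lemma get_unit_scale (R : realType) (phi : R -> R) (r : R) : 0 < r ->
  (forall s t, 0 < s -> s < t -> phi s < phi t) ->
  get [set t | 0 < t /\ phi (r * t^-1) = 1] =
  r * get [set t | 0 < t /\ phi t^-1 = 1].
Proof.
move=> r0 phi_incr; set S := [set t | _]; set S' := [set t | _ /\ phi t^-1 = 1].
have rK t : r * (r^-1 * t) = t by rewrite mulrA divff ?gt_eqF// mul1r.
have SE t : S (r * t) <-> S' t.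
  by rewrite /S /S' /= pmulr_rgt0// invfM rK.
have S'_le s t : S' s -> S' t -> s <= t.
  move=> [s0 s1] [t0 t1]; rewrite leNgt; apply/negP => ts.
  have := phi_incr s^-1 t^-1; rewrite invr_gt0 s0 ltf_pV2 ?posrE// ts s1 t1 ltxx.
  by move=> /(_ isT isT).
have S'_inj s t : S' s -> S' t -> s = t.
  by move=> Ss St; apply/le_anti; rewrite !S'_le.
have [[t S't]|noS'] := pselect (S' !=set0).
  have S'get : S' (r^-1 * get S).
    by apply/SE; rewrite rK; apply: (getI (x := r * t)); exact/SE.
  by rewrite -[LHS]rK; congr (r * _); apply: S'_inj => //; exact: getI S't.
(* Without a solution both sides are the default value of [get], which is 0. *)
rewrite (getPN (_ : forall t, ~ S' t)) => [|t S't]; last by apply: noS'; exists t.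
rewrite (getPN (_ : forall t, ~ S t)) => [|t St]; last first.
  by apply: noS'; exists (r^-1 * t); apply/SE; rewrite rK.
by rewrite -[point]/(0 : R) mulr0.
Qed.

Section DilationGroup.
Variables (R : realType) (d : nat) (A : 'M[R]_d.+1).
Hypothesis symA : A^T = A.

Lemma expmx_cvg (s : R) :
  series (fun k => (k`!%:R)^-1 *: (s *: A) ^+ k) @ \oo --> expmx (s *: A).
Proof.
have [P Punit [v AE]] := symmetric_diagonalizable symA.
have -> : s *: A = invmx P *m diag_mx (s *: v) *m P.
  by rewrite AE [diag_mx (_ *: _)]linearZ /= -!scalemxAr -scalemxAl.
by apply/cvg_ex; eexists; exact: cvg_exp_series_diag.
Qed.

Lemma delta_diag : exists2 P : 'M[R]_d.+1, P \in unitmx &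
  exists v : 'rV[R]_d.+1, forall t,
  delta A t = invmx P *m diag_mx (map_mx (fun x => expR (ln t * x)) v) *m P.
Proof.
have [P Punit [v AE]] := symmetric_diagonalizable symA.
exists P => //; exists v => t.
rewrite /delta (_ : ln t *: A = invmx P *m diag_mx (ln t *: v) *m P); last first.
  by rewrite AE [diag_mx (_ *: _)]linearZ /= -!scalemxAr -scalemxAl.
rewrite /expmx (cvg_lim (@norm_hausdorff _ _) (cvg_exp_series_diag (v := _) Punit)).
congr (_ *m diag_mx _ *m _).
by apply/matrixP => i j; rewrite !mxE.
Qed.

Lemma delta1 : delta A 1 = 1%:M.
Proof.
have [P Punit [v ->]] := delta_diag.
rewrite (_ : map_mx _ _ = const_mx 1); last first.
  by apply/matrixP => i j; rewrite !mxE ln1 mul0r expR0.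
by rewrite diag_const_mx mulmx1 mulVmx.
Qed.

Lemma deltaM (s t : R) : 0 < s -> 0 < t ->
  delta A (s * t) = delta A s *m delta A t.
Proof.
move=> s0 t0; have [P Punit [v deltaE]] := delta_diag.
rewrite !deltaE !mulmxA (mulmxK Punit) -[X in _ = X *m _]mulmxA mulmx_diag.
congr (_ *m diag_mx _ *m _); apply/matrixP => i j.
by rewrite !mxE ord1 lnM// mulrDl expRD.
Qed.

Lemma deltaVK (r : R) : 0 < r -> delta A r *m delta A r^-1 = 1%:M.
Proof. by move=> r0; rewrite -deltaM ?invr_gt0// divff ?gt_eqF// delta1. Qed.

Lemma deltaKV (r : R) : 0 < r -> delta A r^-1 *m delta A r = 1%:M.
Proof. by move=> r0; rewrite -deltaM ?invr_gt0// mulVf ?gt_eqF// delta1. Qed.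

Lemma delta_sym (t : R) : (delta A t)^T = delta A t.
Proof.
have tr_exp k : ((ln t *: A) ^+ k)^T = (ln t *: A) ^+ k.
  elim: k => [|k IHk]; first by rewrite expr0 trmx1.
  by rewrite {1}exprS -[_ * _]/(_ *m _) trmx_mul IHk linearZ /= symA exprSr.
have entry_cvg i j := cvg_comp _ _ (@expmx_cvg (ln t)) (@coord_continuous R _ _ i j _).
apply/matrixP => i j; rewrite mxE; apply: cvg_unique (entry_cvg j i) _ => //.
apply: cvg_trans (entry_cvg i j).
apply: near_eq_cvg; near=> n => /=; rewrite /series /= !summxE.
by apply: eq_bigr => k _; rewrite !mxE -[in LHS]tr_exp mxE.
Unshelve. all: by end_near. Qed.

(** With s the square root of t, <delta_t x, x> = |delta_s x|^2. *)
Lemma delta_posdef (t : R) x : 0 < t -> x != 0 -> 0 < dotp (delta A t *m x) x.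
Proof.
move=> t0 x0; pose s := Num.sqrt t.
have s0 : 0 < s by rewrite sqrtr_gt0.
pose y := delta A s *m x.
have y0 : y != 0.
  apply: contraNN x0 => /eqP y0.
  by rewrite -[x]mul1mx -(deltaKV s0) -mulmxA -/y y0 mulmx0.
rewrite -(sqr_sqrtr (ltW t0)) -/s expr2 deltaM// /dotp -mulmxA trmx_mul delta_sym.
rewrite -mulmxA -/y mxE; have [k yk] : exists k, y k 0 != 0.
  apply/existsP; apply: contraNT y0; rewrite negb_exists => /forallP y0.
  apply/eqP/matrixP => i j; rewrite ord1 [RHS]mxE; apply/eqP.
  by have := y0 i; rewrite negbK.
rewrite (bigD1 k)//= ltr_pwDl//.
  by rewrite mxE -expr2 exprn_even_gt0//= yk orbT.
by apply: sumr_ge0 => i _; rewrite mxE -expr2 sqr_ge0.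
Qed.

Lemma normA_delta (P : 'M[R]_d.+1) (r : R) x :
  (forall xi, xi != 0 -> forall s t, 0 < s -> s < t ->
    normP P (delta A s *m xi) < normP P (delta A t *m xi)) ->
  0 < r -> normA A P (delta A r *m x) = r * normA A P x.
Proof.
move=> incrP r0; rewrite /normA.
have -> : (delta A r *m x == 0) = (x == 0).
  apply/eqP/eqP => [rx0|->]; last by rewrite mulmx0.
  by rewrite -[x]mul1mx -(deltaKV r0) -mulmxA rx0 mulmx0.
case: ifPn => [_|x0]; first by rewrite mulr0.
rewrite -(get_unit_scale r0 (incrP x x0)); congr get.
have deltaE t : 0 < t ->
    delta A t^-1 *m (delta A r *m x) = delta A (r * t^-1) *m x.
  by rewrite -invr_gt0 => t0; rewrite mulmxA -(deltaM t0 r0) (mulrC r).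
by apply/seteqP; split=> t /= [t0]; rewrite (deltaE t t0).
Qed.

End DilationGroup.

(** * Positive definite matrices as products of elementary matrices *)

Section ElementaryProducts.
Variable R : realFieldType.

(** Permutation matrices and negative diagonal entries are left out: neither
    occurs in the elimination of a positive definite matrix, and a reflection
    would not carry half-open boxes to half-open boxes. *)
Inductive elementary_product n : 'M[R]_n -> Prop :=
| ElementaryDiag (v : 'rV_n) : (forall i, 0 < v 0 i) -> elementary_product (diag_mx v)
| ElementaryTransvection (i j : 'I_n) (a : R) :
    i != j -> elementary_product (1%:M + a *: delta_mx i j)
| ElementaryMul M1 M2 : elementary_product M1 -> elementary_product M2 ->
    elementary_product (M1 *m M2).

Lemma elementary_product1 n : elementary_product (1%:M : 'M[R]_n).
Proof. by rewrite -diag_const_mx; constructor=> i; rewrite mxE. Qed.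

Lemma elementary_product_tr n (M : 'M[R]_n) :
  elementary_product M -> elementary_product M^T.
Proof.
elim=> {M} [v v0|i j a ij|M1 M2 _ IH1 _ IH2].
- by rewrite tr_diag_mx; constructor.
- rewrite linearD linearZ /= trmx1 trmx_delta.
  by apply: ElementaryTransvection; rewrite eq_sym.
- by rewrite trmx_mul; constructor.
Qed.

Lemma elementary_product_lift n (M : 'M[R]_n) :
  elementary_product M -> elementary_product (block_mx (1%:M : 'M[R]_1) 0 0 M).
Proof.
elim=> {M} [v v0|i j a ij|M1 M2 _ IH1 _ IH2].
- rewrite -diag_const_mx -diag_mx_row; constructor=> i.
  by rewrite mxE; case: splitP => k _; rewrite ?mxE.
- rewrite (_ : block_mx _ _ _ _
      = 1%:M + a *: delta_mx (rshift 1 i) (rshift 1 j)); last first.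
    rewrite delta_mx_dshift delta_mx_rshift scalar_mx_block -row_mx0.
    by rewrite scale_block_mx add_block_mx !scaler0 !addr0.
  by apply: ElementaryTransvection; rewrite (inj_eq (@rshift_inj _ _)).
- rewrite (_ : block_mx _ _ _ _
    = block_mx (1%:M : 'M[R]_1) 0 0 M1 *m block_mx 1%:M 0 0 M2); first by constructor.
  by rewrite mulmx_block !mulmx0 !mul0mx mulmx1 addr0 !add0r.
Qed.

Lemma elementary_product_lower n (u : 'cV[R]_n) :
  elementary_product (block_mx (1%:M : 'M[R]_1) 0 u 1%:M).
Proof.
rewrite [u]matrix_sum_delta.
elim/big_ind: _ => [|u1 u2 IH1 IH2|i _].
- by rewrite -scalar_mx_block; exact: elementary_product1.
- rewrite (_ : block_mx _ _ _ _
    = block_mx (1%:M : 'M[R]_1) 0 u1 1%:M *m block_mx 1%:M 0 u2 1%:M).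
    by constructor.
  by rewrite mulmx_block !mulmx0 !mul0mx !mulmx1 mul1mx !addr0 add0r.
rewrite big_ord1 (_ : block_mx _ _ _ _
    = 1%:M + u i 0 *: delta_mx (rshift 1 i) (lshift n 0)).
  by apply: ElementaryTransvection; rewrite eq_sym eq_lrshift.
rewrite delta_mx_dshift delta_mx_lshift scalar_mx_block -row_mx0.
by rewrite scale_block_mx add_block_mx !scaler0 !addr0 add0r.
Qed.

(** The corner entry a is positive, and
      [a b; u D] = [1 0; u/a 1] [a 0; 0 S] [1 b/a; 0 1],  S = D - u b / a.
    The form of S at y is the form of M at (- b y / a, y), so the Schur
    complement S is again positive definite and induction applies. *)
Lemma posdef_elementary_product n (M : 'M[R]_n) :
  (forall x : 'cV[R]_n, x != 0 -> 0 < (x^T *m M *m x) 0 0) -> elementary_product M.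
Proof.
elim: n M => [|n IHn] M Mpos.
  rewrite (_ : M = 1%:M); first exact: elementary_product1.
  by apply/matrixP => -[].
rewrite -[n.+1]/(1 + n)%N in M Mpos *.
rewrite -[M]submxK.
set ul := ulsubmx _; set b := ursubmx _; set u := dlsubmx _; set D := drsubmx _.
pose a := ul 0 0.
have ulE : ul = a%:M.
  by apply/matrixP => i j; rewrite !ord1 [RHS]mxE mulr1n.
have MK := submxK M.
have a0 : 0 < a.
  pose x : 'cV[R]_(1 + n) := col_mx 1%:M 0.
  have x0 : x != 0.
    by rewrite col_mx_eq0 negb_and oner_neq0.
  have := Mpos x x0; rewrite /x -MK tr_col_mx mul_row_block trmx1 trmx0 !mul0mx.
  by rewrite !mul1mx mul_row_col mulmx0 mulmx1 !addr0.
pose S := D - a^-1 *: (u *m b).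
have Spos (y : 'cV[R]_n) : y != 0 -> 0 < (y^T *m S *m y) 0 0.
  move=> y0; pose x : 'cV[R]_(1 + n) := col_mx (- a^-1 *: (b *m y)) y.
  have x0 : x != 0 by rewrite col_mx_eq0 negb_and y0 orbT.
  have := Mpos x x0; rewrite /x -MK -mulmxA mul_block_col -/ul -/b -/u -/D.
  rewrite ulE mul_scalar_mx scalerA mulrN divff ?gt_eqF// scaleN1r addNr.
  rewrite tr_col_mx mul_row_col mulmx0 add0r -mulmxA.
  by rewrite /S mulmxBl -scalemxAr -scalemxAl scaleNr mulmxA addrC.
rewrite (_ : block_mx _ _ _ _ =
    block_mx (1%:M : 'M[R]_1) 0 (a^-1 *: u) 1%:M *m
    (block_mx a%:M 0 0 1%:M *m block_mx 1%:M 0 0 S) *m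
    block_mx 1%:M (a^-1 *: b) 0 1%:M).
  apply: ElementaryMul.
    apply: ElementaryMul; first exact: elementary_product_lower.
    apply: ElementaryMul; last exact/elementary_product_lift/IHn.
    rewrite -!diag_const_mx -diag_mx_row; constructor=> i.
    by rewrite mxE; case: splitP => k _; rewrite ?mxE.
  rewrite (_ : block_mx _ _ _ _ = (block_mx 1%:M 0 (a^-1 *: b)^T 1%:M)^T).
    exact/elementary_product_tr/elementary_product_lower.
  by rewrite tr_block_mx !trmx1 trmx0 trmxK.
rewrite !mulmx_block !mulmx0 !mul0mx !mulmx1 !mul1mx !addr0 !add0r ulE.
rewrite -!scalemxAl !mul_scalar_mx !mul_mx_scalar !scalerA !divff ?gt_eqF// !scale1r.
rewrite /S mulVf ?gt_eqF// scale1r mulmx0 scaler0 add0r -scalemxAl -scalemxAr.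
by rewrite !scalerA mulVf ?gt_eqF// mul1r addrC subrK.
Qed.

End ElementaryProducts.

(** * Linear maps and the Lebesgue outer measure *)

Section VolumeScaling.
Variables (R : realType) (d : nat).
Local Notation V := 'cV[R]_d.+1.
Local Notation mu := (@lebesgue_outer R d).
Local Open Scope ereal_scope.

Definition scales_volume (k : R) (f : V -> V) :=
  (0 < k)%R /\ forall X : set V, mu (f @^-1` X) = k%:E * mu X.

Lemma lebesgue_outer_box_le (ab : V * V) :
  (forall i, ab.1 i 0 <= ab.2 i 0)%R -> mu (box ab) <= (volume ab)%:E.
Proof.
move=> ab_le; pose F k := if k == 0%N then ab else (0, 0)%R : V * V.
have F_le k i : ((F k).1 i 0 <= (F k).2 i 0)%R.
  by rewrite /F; case: ifP => _ //=; rewrite lexx.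
apply: ereal_inf_lbound; exists F.
  by split=> // x abx; exists 0%N.
rewrite (@nneseries_recl _ xpredT) => [|k _|]; [|by apply: volume_ge0|by []].
rewrite (@eseries0 _ _ 1) ?adde0// => k k1 _.
by rewrite /F gtn_eqF// /volume (bigD1 ord0)//= subrr mul0r.
Qed.

Lemma lebesgue_outer_preimage_le (f : V -> V) (k : R) : (0 < k)%R ->
  (forall ab : V * V, (forall i, ab.1 i 0 <= ab.2 i 0)%R ->
     mu (f @^-1` box ab) <= (k * volume ab)%:E) ->
  forall X, mu (f @^-1` X) <= k%:E * mu X.
Proof.
move=> k0 f_box X; rewrite -lee_pdivrMl//.
apply: le_ereal_inf_tmp => _ [F [F_le XF] <-]; rewrite lee_pdivrMl//.
have fXF : f @^-1` X `<=` \bigcup_n (f @^-1` box (F n)).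
  by move=> x /XF [n _ Fnx]; exists n.
apply: (le_trans (le_lebesgue_outer fXF)).
apply: (le_trans (lebesgue_outer_sigma_subadditive _)).
rewrite -nneseriesZl; last by move=> n _; apply: volume_ge0 => i; exact: F_le.
apply: lee_nneseries => [n _ _|n _]; first exact: lebesgue_outer_ge0.
by rewrite -EFinM; exact: f_box.
Qed.

(** Each of the two bounds on boxes gives an inequality for all sets by
    subadditivity; the bound for g is the converse one, because
    X = g^-1(f^-1(X)). *)
Lemma scales_volume_bij (f g : V -> V) (k : R) : cancel f g -> cancel g f ->
  (0 < k)%R ->
  (forall ab : V * V, (forall i, ab.1 i 0 <= ab.2 i 0)%R ->
     mu (f @^-1` box ab) <= (k * volume ab)%:E) ->
  (forall ab : V * V, (forall i, ab.1 i 0 <= ab.2 i 0)%R ->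
     mu (g @^-1` box ab) <= (k^-1 * volume ab)%:E) ->
  scales_volume k f.
Proof.
move=> fK gK k0 f_box g_box; split=> // X; apply/eqP; rewrite eq_le.
rewrite lebesgue_outer_preimage_le//= -lee_pdivlMl//.
have XE : X = g @^-1` (f @^-1` X).
  by apply/seteqP; split=> x; rewrite /preimage /= gK.
by rewrite {1}XE; apply: lebesgue_outer_preimage_le; rewrite ?invr_gt0.
Qed.

Lemma scales_volume_comp (f g : V -> V) (k l : R) :
  scales_volume k f -> scales_volume l g -> scales_volume (l * k) (f \o g).
Proof.
move=> [k0 fk] [l0 gl]; split=> [|X]; first exact: mulr_gt0.
by rewrite comp_preimage gl fk EFinM muleA.
Qed.

Lemma scales_volume_translation (c : V) : scales_volume 1 (fun x => x + c)%R.
Proof.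
have box_shift (e : V) (ab : V * V) : (forall i, ab.1 i 0 <= ab.2 i 0)%R ->
    mu ((fun x => x + e)%R @^-1` box ab) <= (volume ab)%:E.
  move=> ab_le; rewrite (_ : _ @^-1` _ = box (ab.1 - e, ab.2 - e)%R); last first.
    apply/seteqP; split=> x abx i; have := abx i;
      by rewrite /= !mxE lerBlDr ltrBrDr.
  rewrite (_ : volume ab = volume (ab.1 - e, ab.2 - e)%R).
    by apply: lebesgue_outer_box_le => i /=; rewrite !mxE lerB.
  by apply: eq_bigr => i _ /=; rewrite !mxE; ring.
apply: (@scales_volume_bij _ (fun x => x - c)%R) => //.
- by move=> x; rewrite addrK.
- by move=> x; rewrite subrK.
- by move=> ab ab_le; rewrite mul1r; exact: box_shift.
- by move=> ab ab_le; rewrite invr1 mul1r; exact: box_shift.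
Qed.

Lemma scales_volume_diag (v : 'rV[R]_d.+1) : (forall i, 0 < v 0 i)%R ->
  scales_volume (\prod_i v 0 i)^-1 (mulmx (diag_mx v)).
Proof.
move=> v0.
have box_diag (w : 'rV[R]_d.+1) (ab : V * V) : (forall i, 0 < w 0 i)%R ->
    (forall i, ab.1 i 0 <= ab.2 i 0)%R ->
    mu (mulmx (diag_mx w) @^-1` box ab) <= ((\prod_i w 0 i)^-1 * volume ab)%:E.
  move=> w0 ab_le; pose s (x : V) := (\col_i (x i 0 / w 0 i))%R : V.
  rewrite (_ : _ @^-1` _ = box (s ab.1, s ab.2)); last first.
    apply/seteqP; split=> x abx i; have := abx i;
      by rewrite mul_diag_mx /= !mxE ler_pdivrMr// ltr_pdivlMr// [(_ * w _ _)%R]mulrC.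
  rewrite (_ : (_ * volume ab)%R = volume (s ab.1, s ab.2)).
    apply: lebesgue_outer_box_le => i /=; rewrite !mxE.
    by rewrite ler_pM2r ?invr_gt0.
  rewrite -prodfV -big_split /=; apply: eq_bigr => i _ /=.
  by rewrite !mxE -mulrBl mulrC.
pose w : 'rV[R]_d.+1 := (\row_i (v 0 i)^-1)%R.
have w0 i : (0 < w 0 i)%R by rewrite mxE invr_gt0.
apply: (@scales_volume_bij _ (mulmx (diag_mx w))).
- move=> x; rewrite mulmxA mulmx_diag -[RHS]mul1mx -diag_const_mx.
  congr (diag_mx _ *m _); apply/matrixP => i j.
  by rewrite !mxE mulVf// gt_eqF.
- move=> x; rewrite mulmxA mulmx_diag -[RHS]mul1mx -diag_const_mx.
  congr (diag_mx _ *m _); apply/matrixP => i j.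
  by rewrite !mxE divff// gt_eqF.
- by rewrite invr_gt0; apply: prodr_gt0.
- by move=> ab; exact: box_diag.
- move=> ab; rewrite -prodfV (_ : (\prod_i _)%R = \prod_i w 0 i)%R.
    exact: box_diag.
  by apply: eq_bigr => i _; rewrite mxE.
Qed.

Lemma mul_transvection (i j : 'I_d.+1) (a : R) (x : V) l :
  (((1%:M + a *: delta_mx i j) *m x) l 0 = x l 0 + (l == i)%:R * (a * x j 0))%R.
Proof.
rewrite mulmxDl mul1mx mxE -scalemxAl mxE; congr +%R.
rewrite mxE (bigD1 j)//= mxE eqxx andbT big1 => [|m /negPf jm].
  by rewrite addr0; ring.
by rewrite mxE jm andbF mul0r.
Qed.

(** Cavalieri's principle: coordinate i is translated by an amount that depends
    on coordinate j only.  Cutting the j-th side of the box into m intervals of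
    length h makes this amount vary by at most |a| h on each strip, so that the
    preimage of each strip lies in a box whose i-th side is longer by
    2 |a| h. *)
Lemma lebesgue_outer_transvection_box_le (i j : 'I_d.+1) (a : R) (ab : V * V) :
  i != j -> (forall i, ab.1 i 0 <= ab.2 i 0)%R ->
  mu (mulmx (1%:M + a *: delta_mx i j)%R @^-1` box ab) <= (volume ab)%:E.
Proof.
move=> ij ab_le; set f := mulmx _; pose w l := (ab.2 l 0 - ab.1 l 0)%R.
have w0 l : (0 <= w l)%R by rewrite subr_ge0.
pose rest := (\prod_(l | (l != i) && (l != j)) w l)%R.
have rest0 : (0 <= rest)%R by exact: prodr_ge0.
have volE (cd : V * V) : (forall l, l != i -> l != j ->
      cd.2 l 0 - cd.1 l 0 = w l)%R ->
    (volume cd = (cd.2 i 0 - cd.1 i 0) * (cd.2 j 0 - cd.1 j 0) * rest)%R.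
  move=> cdE; rewrite /volume (bigD1 i)//= (bigD1 j)/= 1?eq_sym// -mulrA.
  by congr (_ * (_ * _))%R; apply: eq_bigr => l /andP[li lj]; exact: cdE.
(* The total excess volume of the m boxes is C / m. *)
pose C := (2 * `|a| * w j * w j * rest)%R.
have strips m : (0 < m)%N -> mu (f @^-1` box ab) <= (volume ab + C / m%:R)%:E.
  move=> m0; have m0R : (0 < m%:R :> R)%R by rewrite ltr0n.
  pose h := (w j / m%:R)%R.
  have h0 : (0 <= h)%R by rewrite divr_ge0.
  pose t (k : nat) := (ab.1 j 0 + k%:R * h)%R.
  pose lo k : V := (\col_l if l == j then t k else
    if l == i then ab.1 i 0 - a * t k - `|a| * h else ab.1 l 0)%R.
  pose hi k : V := (\col_l if l == j then t k + h else
    if l == i then ab.2 i 0 - a * t k + `|a| * h else ab.2 l 0)%R.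
  have lohi_le k l : ((lo k) l 0 <= (hi k) l 0)%R.
    rewrite !mxE; case: ifP => _; first by rewrite lerDl.
    case: ifP => _; last exact: ab_le.
    have := ab_le i; have : (0 <= `|a| * h)%R by rewrite mulr_ge0.
    by lra.
  have cover : f @^-1` box ab `<=` \big[setU/set0]_(k < m) box (lo k, hi k).
    move=> x fx; have xj : (ab.1 j 0 <= x j 0 < ab.2 j 0)%R.
      by have := fx j; rewrite mul_transvection eq_sym (negPf ij) mul0r addr0.
    have wj0 : (0 < w j)%R by rewrite subr_gt0; case/andP: xj => /le_lt_trans; exact.
    have hgt0 : (0 < h)%R by rewrite divr_gt0.
    (* The index of the strip that contains x. *)
    pose q := ((x j 0 - ab.1 j 0) / h)%R.
    have q0 : (0 <= q)%R by rewrite divr_ge0// subr_ge0; case/andP: xj.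
    have /andP[kq qk] := truncn_itv q0; set k := Num.truncn q in kq qk.
    have km : (k < m)%N.
      rewrite -(ltr_nat R); apply: (le_lt_trans kq).
      rewrite ltr_pdivrMr// /h mulrCA divff ?gt_eqF// mulr1.
      by rewrite ltrD2r; case/andP: xj.
    rewrite ler_pdivlMr// in kq; rewrite ltr_pdivrMr// -natr1 mulrDl mul1r in qk.
    have xjt : (`|x j 0 - t k| <= h)%R by rewrite ler_norml /t; apply/andP; split; lra.
    have axj : (`|a * x j 0 - a * t k| <= `|a| * h)%R.
      by rewrite -mulrBr normrM ler_wpM2l.
    move: axj; rewrite ler_norml => /andP[axj1 axj2].
    rewrite -(bigcup_mkord m (fun k => box (lo k, hi k))).
    exists k => // l; rewrite !mxE.
    have := fx l; rewrite mul_transvection.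
    have [->|lj] := eqVneq l j.
      by move=> _; rewrite /t; apply/andP; split; lra.
    have [->|li] := eqVneq l i; last by rewrite mul0r addr0.
    by rewrite mul1r => /andP[x1 x2]; apply/andP; split; lra.
  apply: (le_trans (le_lebesgue_outer cover)).
  apply: (le_trans (outer_measure_subadditive mu (fun k => box (lo k, hi k)) m)).
  apply: (@le_trans _ _ (\sum_(k < m) (h * (w i + 2 * `|a| * h) * rest)%:E)).
    apply: lee_sum => k _.
    apply: (le_trans (@lebesgue_outer_box_le (lo k, hi k) (lohi_le k))).
    rewrite lee_fin (volE (lo k, hi k)) /=.
      by rewrite !mxE !eqxx (negPf ij) /w le_eqVlt; apply/orP; left; apply/eqP; ring.
    by move=> l /negPf li /negPf lj; rewrite !mxE li lj.
  rewrite sumEFin lee_fin sumr_const card_ord -mulr_natl (volE ab)// -/(w i) -/(w j).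
  by rewrite /h /C le_eqVlt; apply/orP; left; apply/eqP; field; rewrite gt_eqF.
apply/lee_addgt0Pr => e e0; have C0 : (0 <= C)%R by rewrite !mulr_ge0.
apply: (le_trans (strips (Num.truncn (C / e)).+1 isT)).
rewrite -EFinD lee_fin lerD2l ler_pdivrMr ?ltr0n// mulrC -ler_pdivrMr//.
by have /andP[_ /ltW] := truncn_itv (divr_ge0 C0 (ltW e0)).
Qed.

Lemma scales_volume_transvection (i j : 'I_d.+1) (a : R) : i != j ->
  scales_volume 1 (mulmx (1%:M + a *: delta_mx i j)%R).
Proof.
move=> ij.
have transvectionK (b : R) : cancel (mulmx (1%:M + b *: delta_mx i j)%R)
    (mulmx (1%:M - b *: delta_mx i j)%R : V -> V).
  move=> x; apply/matrixP => l z; rewrite ord1 -scaleNr !mul_transvection.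
  by rewrite [j == i]eq_sym (negPf ij) mul0r addr0; ring.
apply: (@scales_volume_bij _ (mulmx (1%:M - a *: delta_mx i j)%R)) => //.
- by move=> x; have := transvectionK (- a)%R x; rewrite scaleNr opprK.
- by move=> ab ab_le; rewrite mul1r; exact: lebesgue_outer_transvection_box_le.
- move=> ab ab_le; rewrite invr1 mul1r -scaleNr.
  exact: lebesgue_outer_transvection_box_le.
Qed.

Lemma scales_volume_elementary_product (M : 'M[R]_d.+1) :
  elementary_product M -> exists k, scales_volume k (mulmx M : V -> V).
Proof.
elim=> {M} [v v0|i j a ij|M1 M2 _ [k1 scale1] _ [k2 scale2]].
- by eexists; exact: scales_volume_diag.
- by eexists; exact: scales_volume_transvection.
- have MM : mulmx (M1 *m M2) = mulmx M1 \o mulmx M2 :> (V -> V).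
    by apply/funext => x /=; rewrite mulmxA.
  by exists (k2 * k1)%R; rewrite MM; exact: scales_volume_comp scale1 scale2.
Qed.

End VolumeScaling.

(** * Bijections that multiply a measure by a constant *)

Section ChangeOfVariables.
Context {dsp : measure_display} {T : measurableType dsp} {R : realType}.
Variable mu : {measure set T -> \bar R}.
Local Open Scope ereal_scope.
Import HBSimple HBNNSimple.

Lemma nnsfun_comp (f : T -> T) (h : {nnsfun T >-> R}) :
  measurable_fun setT f -> exists hf : {nnsfun T >-> R}, hf =1 h \o f.
Proof.
move=> mf.
have mhf : measurable_fun setT (h \o f) by exact: measurableT_comp.
have fhf : finite_set (range (h \o f)).
  by apply: sub_finite_set (fimfunP h) => _ [x _ <-]; exists (f x).
have nhf x : (0 <= (h \o f) x)%R by exact: fun_ge0.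
pose hf := h \o f.
pose c1 := isMeasurableFun.Build _ _ _ _ hf mhf.
pose c2 := FiniteImage.Build _ _ hf fhf.
pose c3 := isNonNegFun.Build _ _ hf nhf.
pose s : {nnsfun T >-> R} := HB.pack hf c1 c2 c3.
by exists s.
Qed.

Variables (f g : T -> T) (k : R).
Hypotheses (fK : cancel f g) (gK : cancel g f).
Hypotheses (mf : measurable_fun setT f) (mg : measurable_fun setT g).
Hypotheses (k0 : (0 < k)%R).
Hypothesis mu_preimage : forall X, measurable X -> mu (f @^-1` X) = k%:E * mu X.

Lemma sintegral_comp (h : {nnsfun T >-> R}) :
  sintegral mu (h \o f) = k%:E * sintegral mu h.
Proof.
rewrite !sintegralET ge0_mule_fsumr; last exact: nnsfun_mulemu_ge0.
apply: eq_fsbigr => x _.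
by rewrite comp_preimage mu_preimage// muleCA.
Qed.

(** The integral of a nonnegative function h is the supremum of the integrals of
    the simple functions below h, and s |-> s o f is a bijection from the simple
    functions below h to those below h o f; so the formula holds for every
    nonnegative h. *)
Lemma ge0_integral_comp (h : T -> \bar R) : (forall x, 0 <= h x) ->
  \int[mu]_x h (f x) = k%:E * \int[mu]_x h x.
Proof.
move=> h0; rewrite !ge0_integralTE//; apply/eqP; rewrite eq_le; apply/andP; split.
  apply: ge_ereal_sup => _ [s s_le <-].
  have [sg sgE] := nnsfun_comp s mg.
  rewrite (eq_sintegral (sg \o f)); last by move=> x /=; rewrite sgE /= fK.
  rewrite sintegral_comp lee_pmul2l//; apply: ereal_sup_ubound.
  by exists sg => // x; rewrite sgE /= -[in leRHS](gK x).
rewrite -lee_pdivlMl//; apply: ge_ereal_sup => _ [s s_le <-].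
rewrite lee_pdivlMl// -sintegral_comp.
have [sf sfE] := nnsfun_comp s mf.
apply: ereal_sup_ubound; exists sf; first by move=> x; rewrite sfE; exact: s_le.
exact: eq_sintegral.
Qed.

Lemma ge0_integral_preimage (E : set T) (h : T -> \bar R) :
  (forall x, 0 <= h x) ->
  \int[mu]_(x in f @^-1` E) h (f x) = k%:E * \int[mu]_(x in E) h x.
Proof.
move=> h0; rewrite integral_mkcond [in RHS]integral_mkcond -ge0_integral_comp.
  by apply: eq_integral => x _; rewrite /patch; congr (if _ then _ else _).
by move=> x; rewrite /patch; case: ifP.
Qed.

Lemma ae_preimage (Q : T -> Prop) :
  (\forall x \ae mu, Q (f x)) <-> (\forall x \ae mu, Q x).
Proof.
split=> -[N [mN N0 QN]].
  have mgN : measurable (g @^-1` N) by rewrite -[_ @^-1` _]setTI; exact: mg.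
  exists (g @^-1` N); split=> //.
    have := mu_preimage mgN; rewrite -comp_preimage (_ : g \o f = id); last first.
      by apply/funext => x /=; rewrite fK.
    rewrite preimage_id N0 => /esym/eqP; rewrite mule_eq0 eqe gt_eqF//=.
    by move=> /eqP.
  by move=> x /= nQx; apply: QN => /=; rewrite gK.
exists (f @^-1` N); split.
- by rewrite -[_ @^-1` _]setTI; exact: mf.
- by rewrite mu_preimage// N0 mule0.
- by move=> x /= nQx; exact: QN.
Qed.

End ChangeOfVariables.

(** * Invariance of averages and of the weight constant *)

(** Caratheodory's condition for f^-1(X) on a test set Y is k times the
    condition for X on the test set g^-1(Y). *)
Lemma scales_volume_measurable (R : realType) d (k : R) (f g : Rd R d -> Rd R d) :
  cancel f g -> cancel g f -> scales_volume k f -> measurable_fun setT f.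
Proof.
move=> fK gK [k0 fk] _ X mX; rewrite setTI.
have {}mX : caratheodory_measurable (@lebesgue_outer R d) X := mX.
change (caratheodory_measurable (@lebesgue_outer R d) (f @^-1` X)) => Y.
have YE : Y = f @^-1` (g @^-1` Y) by apply/seteqP; split=> x; rewrite /preimage /= fK.
have YI Z : Y `&` f @^-1` Z = f @^-1` (g @^-1` Y `&` Z).
  by rewrite preimage_setI -YE.
rewrite preimage_setC !YI {1}YE !fk -ge0_muleDr ?lebesgue_outer_ge0//.
congr (_ * _)%E; exact: mX.
Qed.

Section AverageInvariance.
Variables (R : realType) (d : nat) (k : R) (f g : Rd R d -> Rd R d).
Hypotheses (fK : cancel f g) (gK : cancel g f) (fk : scales_volume k f).
Local Open Scope ereal_scope.

Let mf : measurable_fun setT f := scales_volume_measurable fK gK fk.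

Let mg : measurable_fun setT g.
Proof.
have [k0 fkE] := fk; apply: (@scales_volume_measurable _ _ k^-1 _ f) => //.
split=> [|X]; first by rewrite invr_gt0.
have XE : X = f @^-1` (g @^-1` X) by apply/seteqP; split=> x; rewrite /preimage /= fK.
by rewrite {2}XE fkE muleA -EFinM mulVf ?gt_eqF// mul1e.
Qed.

(** The constant cancels also for sets of measure 0 or infinity, with the
    conventions 1/0 = oo and 1/oo = 0. *)
Lemma avg_preimage (E : set (Rd R d)) (h : Rd R d -> \bar R) :
  (forall x, 0 <= h x) -> avg (f @^-1` E) (h \o f) = avg E h.
Proof.
move=> h0; have [k0 fkE] := fk; rewrite /avg.
have -> : \int[lebesgue_Rd]_(x in f @^-1` E) (h \o f) x =
    k%:E * \int[lebesgue_Rd]_(x in E) h x.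
  exact: (@ge0_integral_preimage _ _ _ lebesgue_Rd _ _ _ fK gK mf mg k0
    (fun X _ => fkE X)).
have -> : lebesgue_Rd (f @^-1` E) = k%:E * lebesgue_Rd E := fkE E.
have -> : (k%:E * lebesgue_Rd E)^-1 = k^-1%:E * (lebesgue_Rd E)^-1.
  have : 0 <= lebesgue_Rd E := lebesgue_outer_ge0 E.
  case: (lebesgue_Rd E) => [x x0| _ |//].
    have [->|xN0] := eqVneq x 0%R.
      by rewrite mule0 inve0 gt0_muley// lte_fin invr_gt0.
    by rewrite -EFinM !inver mulf_eq0 (gt_eqF k0) (negPf xN0)/= invfM EFinM.
  by rewrite gt0_muley ?lte_fin// invey mule0.
by rewrite muleACA -EFinM mulVf ?gt_eqF// mul1e.
Qed.

Lemma ess_sup_in_preimage (E : set (Rd R d)) (h : Rd R d -> \bar R) :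
  ess_sup_in (f @^-1` E) (h \o f) = ess_sup_in E h.
Proof.
have [k0 fkE] := fk; congr ereal_inf; apply/seteqP; split=> y /=.
  exact: (@ae_preimage _ _ _ lebesgue_Rd _ _ _ fK gK mf mg k0 (fun X _ => fkE X)
    (fun t => E t -> h t <= y)).1.
exact: (@ae_preimage _ _ _ lebesgue_Rd _ _ _ fK gK mf mg k0 (fun X _ => fkE X)
  (fun t => E t -> h t <= y)).2.
Qed.

Section ApConst.
Variables (N : nat) (nrm : 'M[R[i]]_N -> R) (A P : 'M[R]_d.+1) (p : R).
Implicit Types W : Rd R d -> 'M[R[i]]_N.

Let term_le1 W (E : set (Rd R d)) := ess_sup_in E (fun t =>
  avg E (fun x => ((Ap_kernel nrm p W x t) `^ p)%:E)).

Let term_gt1 W (E : set (Rd R d)) := (avg E (fun x =>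
  (avg E (fun t => ((Ap_kernel nrm p W x t) `^ conj_exp p)%:E))
    `^ (p / conj_exp p)%R)) `^ p^-1.

Let avg_kernel_left W (q : R) (E : set (Rd R d)) t :
  avg (f @^-1` E) (fun x => ((Ap_kernel nrm p (W \o f) x t) `^ q)%:E) =
  avg E (fun x => ((Ap_kernel nrm p W x (f t)) `^ q)%:E).
Proof.
apply: (@avg_preimage E (fun x => ((Ap_kernel nrm p W x (f t)) `^ q)%:E)) => x.
by rewrite lee_fin powR_ge0.
Qed.

Let avg_kernel_right W (q : R) (E : set (Rd R d)) x :
  avg (f @^-1` E) (fun t => ((Ap_kernel nrm p (W \o f) x t) `^ q)%:E) =
  avg E (fun t => ((Ap_kernel nrm p W (f x) t) `^ q)%:E).
Proof.
apply: (@avg_preimage E (fun t => ((Ap_kernel nrm p W (f x) t) `^ q)%:E)) => t.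
by rewrite lee_fin powR_ge0.
Qed.

Let term_le1_preimage W E : term_le1 (W \o f) (f @^-1` E) = term_le1 W E.
Proof.
pose h t := avg E (fun x => ((Ap_kernel nrm p W x t) `^ p)%:E).
transitivity (ess_sup_in (f @^-1` E) (h \o f)).
  apply: (congr1 (ess_sup_in (f @^-1` E))); apply/funext => t.
  exact: avg_kernel_left.
exact: ess_sup_in_preimage.
Qed.

Let term_gt1_preimage W E : term_gt1 (W \o f) (f @^-1` E) = term_gt1 W E.
Proof.
pose h x := avg E (fun t => ((Ap_kernel nrm p W x t) `^ conj_exp p)%:E)
  `^ (p / conj_exp p)%R.
transitivity (avg (f @^-1` E) (h \o f) `^ p^-1).
  apply: (congr1 (fun u => avg (f @^-1` E) u `^ p^-1)); apply/funext => x.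
  apply: (congr1 (fun y => y `^ (p / conj_exp p)%R)).
  exact: avg_kernel_right.
by rewrite avg_preimage// => x; exact: poweR_ge0.
Qed.

Lemma Ap_const_comp W :
  (forall E, ballsA A P E -> ballsA A P (f @^-1` E)) ->
  (forall E, ballsA A P E -> ballsA A P (g @^-1` E)) ->
  Ap_const nrm A P p (W \o f) = Ap_const nrm A P p W.
Proof.
move=> f_balls g_balls.
have sup_balls (F G : set (Rd R d) -> \bar R) :
    (forall E, F (f @^-1` E) = G E) ->
    ereal_sup [set F E | E in ballsA A P] = ereal_sup [set G E | E in ballsA A P].
  move=> FG; congr ereal_sup; apply/seteqP; split=> _ [E BE <-].
    exists (g @^-1` E); first exact: g_balls.
    by rewrite -FG; congr F; apply/seteqP; split=> x; rewrite /preimage /= fK.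
  by exists (f @^-1` E); [exact: f_balls|exact: FG].
rewrite /Ap_const; case: (p <= 1)%R.
  exact: (sup_balls _ _ (term_le1_preimage W)).
exact: (sup_balls _ _ (term_gt1_preimage W)).
Qed.

End ApConst.

End AverageInvariance.

Theorem lemma4p6 (R : realType) (d N : nat)
  (A P : 'M[R]_d.+1) (hAP : dilation_structure A P)
  (nrm : 'M[R[i]]_N -> R) (hnrm : matrix_norm nrm)
  (p : R) (hp : 0 < p)
  (W : Rd R d -> 'M[R[i]]_N) (hW : in_Ap nrm A P p W)
  (r : R) (hr : 0 < r) (c : 'cV[R]_d.+1) :
  Ap_const nrm A P p (W \o (fun x : Rd R d => delta A r *m x + c)) = Ap_const nrm A P p W.
Proof.
have symA := dil_sym hAP; have r0V : 0 < r^-1 by rewrite invr_gt0.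
set f := fun x : Rd R d => _.
pose g (y : Rd R d) : Rd R d := delta A r^-1 *m (y - c).
have fK : cancel f g by move=> x; rewrite /f /g addrK mulmxA deltaKV// mul1mx.
have gK : cancel g f by move=> x; rewrite /f /g mulmxA deltaVK// mul1mx subrK.
have [k fk] : exists k, scales_volume k f.
  have [k Mk] : exists k, scales_volume k (mulmx (delta A r) : Rd R d -> Rd R d).
    apply: scales_volume_elementary_product; apply: posdef_elementary_product.
    move=> x x0; have := delta_posdef symA hr x0.
    by rewrite /dotp trmx_mul delta_sym.
  exists (k * 1)%R; exact: scales_volume_comp (scales_volume_translation c) Mk.
have normA_r x : normA A P (delta A r *m x) = r * normA A P x.
  by apply: normA_delta => //; exact: dilP_incr hAP.
have sub_f u x : u - f x = delta A r *m (g u - x).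
  by rewrite mulmxBr /g mulmxA deltaVK// mul1mx /f opprD addrA addrAC.
have f_sub u x : f u - x = delta A r *m (u - g x).
  by rewrite mulmxBr /g mulmxA deltaVK// mul1mx /f opprB addrA.
apply: (Ap_const_comp fK gK fk) => _ [xi [s s0 ->]].
  exists (g xi); exists (r^-1 * s); first exact: mulr_gt0.
  apply/seteqP; split=> x; rewrite /ballA /preimage /= sub_f normA_r;
    by rewrite ltr_pdivlMl.
exists (f xi); exists (r * s); first exact: mulr_gt0.
apply/seteqP; split=> x; rewrite /ballA /preimage /= f_sub normA_r;
  by rewrite ltr_pM2l.
Qed.
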